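(* Let $n\ge1$, $[n]=\{1,\dots,n\}$, and let $\mathcal{G}=(u_i,X_i)_{i\in[n]}$ be an abstract individually quasi-Leontief game, with nonempty strategy spaces $X_i$, such that: (1) each strategy space $X_i$ is a compact metrizable topological inf-semilattice with path-connected intervals; (2) each payoff function $u_i:\prod_{j\in[n]}X_j\to\mathbb{R}$ is continuous. Then $\mathcal{G}$ has a Nash point, i.e. there is $x^\star\in\prod_{j\in[n]}X_j$ such that for all $i\in[n]$ and all $x_i\in X_i$, $u_i(x^\star)\ge u_i(x^\star_{-i};x_i)$.
   Context: An inf-semilattice is a partially ordered set in which every two elements $x,y$ have a greatest lower bound $x\wedge y$; it is a topological inf-semilattice if it carries a topology for which $\wedge$ is continuous. It has path-connected intervals if for all $x\le y$ the order interval $[x,y]=\{z:x\le z\le y\}$ is path connected. A function $u:X\to\mathbb{R}$ on a partially ordered set is quasi-Leontief if for every $x\in X$ the set $\{x'\in X:u(x')\ge u(x)\}$ equals $\{x'\in X:x'\ge a\}$ for some $a\in X$. For $x\in\prod_jX_j$, $x_{-i}=(x_j)_{j\neq i}$ and $(x_{-i};z_i)$ is $x$ with the $i$-th coordinate replaced by $z_i$. The game is individually quasi-Leontief if each payoff $u_i$ is individually quasi-Leontief, i.e. for every $j\in[n]$ and every $x_{-j}\in\prod_{k\ne j}X_k$ the partial function $z_j\mapsto u_i(x_{-j};z_j)$ is quasi-Leontief on $X_j$. *)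

(* Defs.v *)
From mathcomp Require Import all_boot all_order all_algebra.
From mathcomp Require Import all_classical all_reals all_analysis.

Set Implicit Arguments.
Unset Strict Implicit.
Unset Printing Implicit Defensive.

Import Order.TTheory GRing.Theory Num.Theory.
Import numFieldNormedType.Exports.

Local Open Scope classical_set_scope.
Local Open Scope ring_scope.

Definition topological_inf_semilattice (d : Order.disp_t)
    (T : POrderedTopological.type d) : Prop :=
  exists meet : T -> T -> T,
    (forall x y : T, infimums [set x; y] (meet x y)) /\
    continuous (fun p : T * T => meet p.1 p.2).

(* Nonnegativity of the distance follows from the four stated axioms. *)
Definition metrizable (R : realType) (T : topologicalType) : Prop :=
  exists dist : T -> T -> R,
    [/\ forall x, dist x x = 0,
        forall x y, dist x y = 0 -> x = y,
        forall x y, dist x y = dist y x,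
        forall x y z, dist x z <= dist x y + dist y z &
        forall (x : T) (A : set T),
          nbhs x A <-> exists2 e : R, 0 < e & [set y | dist x y < e] `<=` A].

(* A path is a function on all of R of which only the restriction to the
   unit interval matters. *)
Definition path_connected (R : realType) (T : topologicalType) (A : set T) :
    Prop :=
  forall a b, A a -> A b -> exists g : R -> T,
    [/\ {within `[0, 1]%classic, continuous g}, g 0 = a, g 1 = b &
        g @` `[0, 1]%classic `<=` A].

Definition path_connected_intervals (R : realType) (d : Order.disp_t)
    (T : POrderedTopological.type d) : Prop :=
  forall x y : T, (x <= y)%O -> path_connected R (`[x, y]%classic : set T).

Definition quasi_leontief (R : realType) (d : Order.disp_t)
    (T : porderType d) (u : T -> R) : Prop :=
  forall x : T, exists a : T,
    [set x' : T | u x <= u x'] = [set x' : T | (a <= x')%O].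

Section Game.
Context (R : realType) (n : nat) (d : Order.disp_t)
  (X : 'I_n -> POrderedTopological.type d).

(* [dfwith x j z] is the profile (x_{-j}; z): the value x j is discarded, so
   quantifying over x amounts to quantifying over x_{-j} when X j is nonempty. *)
Definition individually_quasi_leontief (u : prod_topology X -> R) : Prop :=
  forall (j : 'I_n) (x : prod_topology X),
    quasi_leontief (fun z : X j => u (dfwith x j z)).

Definition individually_quasi_leontief_game
    (u : 'I_n -> prod_topology X -> R) : Prop :=
  forall i, individually_quasi_leontief (u i).

Definition nash_point (u : 'I_n -> prod_topology X -> R)
    (x : prod_topology X) : Prop :=
  forall (i : 'I_n) (xi : X i), u i x >= u i (dfwith x i xi).
End Game.

(* Main.v *)
(* The best replies of a player form a principal filter, so a strategy that
   dominates the infimum of some profitable deviations is itself at least as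
   good as one of them.  For finitely many allowed deviations per player, a
   weight vector on the deviations is mapped to a strategy dominating the
   infimum of the deviations of positive weight; this is done continuously by
   taking infima along paths of order intervals.  Raising the weight of the
   deviations whose gain exceeds half of the maximal gain, and lowering the
   others, is a continuous self-map of a cube, and a fixed point with positive
   maximal gain would be a strategy that strictly improves on itself.
   Compactness of the space of profiles then handles all deviations at once.

   Brouwer's theorem on the cube is obtained from a mod 2 Stokes formula for
   the cup product of the coboundaries of Boolean labels on Kuhn's
   triangulation, the k-th label telling whether the map does not decrease the
   k-th coordinate. *)
Require Import Defs.
From mathcomp Require Import all_boot all_order all_algebra.
From mathcomp Require Import all_classical all_reals all_analysis.
From mathcomp Require Import finmap lra.
Import numFieldNormedType.Exports.

Set Implicit Arguments.
Unset Strict Implicit.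
Unset Printing Implicit Defensive.

(** * Mod 2 cochains on ordered simplices *)

Section Cochains.
Context (V : Type).
Implicit Types (phi : seq V -> bool) (l : seq V).

(** The mod 2 coboundary: the faces of [v :: l'] are [l'] and the faces of [l'] with [v] put back in
    front. *)
Fixpoint cobd phi l : bool :=
  if l is v :: l' then phi l' (+) cobd (fun s => phi (v :: s)) l' else false.

Lemma cobd_cons phi v l :
  cobd phi (v :: l) = phi l (+) cobd (fun s => phi (v :: s)) l.
Proof. by []. Qed.

Lemma cobdD phi psi l :
  cobd (fun s => phi s (+) psi s) l = cobd phi l (+) cobd psi l.
Proof.
by elim: l phi psi => [//|v l IHl] phi psi /=; rewrite IHl addbACA.
Qed.

Lemma cobd_andl b phi l : cobd (fun s => b && phi s) l = b && cobd phi l.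
Proof.
by elim: l phi => [|v l IHl] phi /=; rewrite ?andbF // IHl andb_addr.
Qed.

Lemma cobd_cobd phi l : cobd (cobd phi) l = false.
Proof.
elim: l phi => [//|v l IHl] phi /=.
by rewrite (cobdD phi) IHl addbF addbb.
Qed.

End Cochains.

Lemma cobd_map (V W : Type) (f : V -> W) (phi : seq W -> bool) (l : seq V) :
  cobd phi (map f l) = cobd (fun s => phi (map f s)) l.
Proof. by elim: l phi => [//|v l IHl] phi /=; rewrite IHl. Qed.

(** * The prism operator *)

Section Prism.
Context (V W : Type) (top bot : V -> W).
Implicit Types (phi psi : seq W -> bool) (l : seq V).

(** The sum of [phi] over the simplices [bot v0, ..., bot vi, top vi, ..., top vr] that triangulate
    the prism over [v0, ..., vr]. *)
Fixpoint prism phi l : bool :=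
  if l is v :: l' then
    phi (bot v :: top v :: map top l') (+) prism (fun s => phi (bot v :: s)) l'
  else false.

Lemma eq_prism phi psi : phi =1 psi -> prism phi =1 prism psi.
Proof.
move=> + l; elim: l phi psi => [//|v l IHl] phi psi e /=.
by rewrite e (IHl _ (fun s => psi (bot v :: s))).
Qed.

Lemma prismD phi psi l :
  prism (fun s => phi s (+) psi s) l = prism phi l (+) prism psi l.
Proof.
by elim: l phi psi => [//|v l IHl] phi psi /=; rewrite IHl addbACA.
Qed.

(** Chain homotopy: the boundary of a prism consists of its two ends and of the prism over the
    boundary of its base. *)
Lemma prism_cobd phi l :
  prism (cobd phi) l =
    cobd (prism phi) l (+) (phi (map top l) (+) phi (map bot l)).
Proof.
elim: l phi => [|v l IHl] phi /=; first by rewrite addbb.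
rewrite (prismD phi) IHl (cobdD (fun s => phi (bot v :: top v :: map top s))).
rewrite -(cobd_map top (fun s => phi (bot v :: top v :: s))).
by case: (prism _ l); case: (cobd _ l); case: (cobd _ _);
  case: (phi _); case: (phi _); case: (phi _).
Qed.

End Prism.

Lemma prism_eq0 (V W : eqType) (top bot : V -> W) phi (l : seq V) :
  (forall s, {subset s <= map bot l ++ map top l} -> phi s = false) ->
  prism top bot phi l = false.
Proof.
elim: l phi => [//|v l IHl] phi phi0 /=; rewrite phi0 ?IHl // => [s sl|w].
- apply: phi0 => w; rewrite /= !inE => /predU1P[->|/sl]; first by rewrite eqxx.
  by rewrite !mem_cat inE => /orP[]->; rewrite !orbT.
- by rewrite /= !(inE, mem_cat) => /or3P[]->; rewrite ?orbT.
Qed.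

Section Gradients.
Context (V : Type).
Implicit Types (F : nat -> V -> bool) (l : seq V).

Definition cup (f : V -> bool) (phi : seq V -> bool) l : bool :=
  if l is v :: _ then f v && phi l else false.

(* The cup product of the coboundaries of [F 0], ..., [F K.-1]. *)
Fixpoint grad F K : seq V -> bool :=
  if K is K'.+1 then cobd (cup (F 0) (grad (fun k => F k.+1) K'))
  else fun l => size l == 1.

Lemma gradS F K : grad F K.+1 = cobd (cup (F 0) (grad (fun k => F k.+1) K)).
Proof. by []. Qed.

Lemma cobd_grad F K l : cobd (grad F K) l = false.
Proof.
case: K => [|K]; last exact: cobd_cobd.
case: l => [//|v [//|w [//|x l]]] /=.
have cobd0 s : cobd (fun=> false) s = false :> bool by elim: s => [|y s IHs].
by rewrite cobd0.
Qed.

(** Leibniz rule: the remaining factor is a cocycle, so only the coboundary of [F 0] on the first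
    edge survives. *)
Lemma grad_cons F K v w l :
  grad F K.+1 (v :: w :: l) =
    (F 0 v (+) F 0 w) && grad (fun k => F k.+1) K (w :: l).
Proof.
have := cobd_grad (fun k => F k.+1) K (v :: w :: l).
rewrite gradS.
move: (grad _ K) => G.
rewrite (cobd_cons G) (cobd_cons (cup _ _)).
rewrite (cobd_andl (F 0 v) (fun s => G (v :: s))) /cup.
by case: (G _); case: (cobd _ _); case: (F 0 v); case: (F 0 w).
Qed.

End Gradients.

Lemma grad_map (V W : Type) (f : V -> W) (F : nat -> W -> bool) K l :
  grad F K (map f l) = grad (fun k => F k \o f) K l.
Proof.
elim: K F l => [|K IHK] F l; first by rewrite /= size_map.
by case: l => [//|v [//|w l]]; rewrite !map_cons !grad_cons -map_cons IHK.
Qed.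

Lemma grad_const (V : eqType) (F : nat -> V -> bool) K k (l : seq V) :
    k < K -> {in l &, forall v w, F k v = F k w} ->
  grad F K l = false.
Proof.
elim: K k F l => [//|K IHK] [|k] F l ltkK Fl; case: l Fl => [//|v [//|w l]] Fl.
- by rewrite grad_cons (Fl v w) ?addbb // !inE eqxx ?orbT.
- rewrite grad_cons (IHK k (fun k => F k.+1)) ?andbF // => x y xl yl.
  by apply: Fl; rewrite inE ?xl ?yl orbT.
Qed.

Lemma telescope_addb (G : nat -> bool) n :
  \big[addb/false]_(j < n) (G j.+1 (+) G j) = G n (+) G 0.
Proof.
elim: n => [|n IHn]; first by rewrite big_ord0 addbb.
rewrite big_ord_recr /= IHn.
by case: (G n); case: (G 0); case: (G _).
Qed.

(** * Stokes' formula on Kuhn's triangulation *)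

Section Grid.
Context (N : nat).

(* Vertices of the grid {0, ..., N}^K are sequences of naturals; [grid K phi]
   sums [phi] over the simplices of Kuhn's triangulation, built one coordinate
   at a time as prisms. *)
Fixpoint grid K (phi : seq (seq nat) -> bool) : bool :=
  if K is K'.+1 then
    \big[addb/false]_(j < N) grid K' (prism (cons j.+1) (cons (j : nat)) phi)
  else phi [:: [::]].

Lemma eq_grid K phi psi : phi =1 psi -> grid K phi = grid K psi.
Proof.
elim: K phi psi => [|K IHK] phi psi e; first exact: e.
by apply: eq_bigr => j _; apply/IHK/eq_prism.
Qed.

Lemma gridD K phi psi :
  grid K (fun l => phi l (+) psi l) = grid K phi (+) grid K psi.
Proof.
elim: K phi psi => [//|K IHK] phi psi /=; rewrite -big_split /=.
by apply: eq_bigr => j _; rewrite -IHK; apply/eq_grid => l; rewrite prismD.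
Qed.

Definition cell K (p v : seq nat) : Prop :=
  forall k, k < K -> nth 0 p k <= nth 0 v k <= (nth 0 p k).+1.

(** Each simplex of the triangulation lies in a unit cube of the grid. *)
Lemma grid_cell K phi :
    (forall p l, (forall k, k < K -> nth 0 p k < N) ->
       {in l, forall v, cell K p v} -> phi l = false) ->
  grid K phi = false.
Proof.
elim: K phi => [|K IHK] phi phi0 /=; first exact: (phi0 [::]).
rewrite big1 // => j _; apply: IHK => p l pN lp; apply: prism_eq0 => s sl.
apply: (phi0 (val j :: p)) => [[|k] //= /pN//|v /sl].
by rewrite mem_cat => /orP[] /mapP[w /lp wp ->] [|k] //= => [_|/wp//|_|/wp//];
  rewrite leqnn leqnSn.
Qed.

(** With [K0 = 1] the two faces orthogonal to the first coordinate are left out; they give the two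
    terms of [grid_boundary]. *)
Definition side K0 K (l : seq (seq nat)) : Prop :=
  exists2 k, K0 <= k < K & exists2 c, c \in [:: 0; N] &
    {in l, forall v, nth 0 v k = c}.

(* The first hypothesis is [grid_side], proved by mutual induction. *)
Lemma grid_boundary K phi :
    (forall phi, phi [::] = false -> (forall l, side 0 K l -> phi l = false) ->
       grid K (cobd phi) = false) ->
    (forall l, side 1 K.+1 l -> phi l = false) ->
  grid K.+1 (cobd phi) = grid K (fun l => phi (map (cons N) l)) (+)
                         grid K (fun l => phi (map (cons 0) l)).
Proof.
move=> IH phi0 /=; set G := fun j => grid K (fun l => phi (map (cons j) l)).
rewrite (eq_bigr (fun j : 'I_N => G j.+1 (+) G j)) => [|j _].
  exact: telescope_addb.
rewrite (eq_grid _ (prism_cobd _ _ _)) !gridD IH ?addFb // => l.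
case=> k /andP[_ ltkK] [c cN lc].
apply: prism_eq0 => s sl; apply: phi0; exists k.+1; first by rewrite ltnS.
by exists c => // v /sl; rewrite mem_cat => /orP[] /mapP[w /lc wk ->].
Qed.

(** Stokes without boundary terms. The value at [[::]] matters in dimension 0, where the only face
    of the vertex is empty. *)
Lemma grid_side K phi :
    phi [::] = false -> (forall l, side 0 K l -> phi l = false) ->
  grid K (cobd phi) = false.
Proof.
elim: K phi => [|K IHK] phi phi_nil phi0; first by rewrite /= phi_nil.
rewrite grid_boundary // => [|l [k /andP[_ ltkK] lk]]; last first.
  by apply: phi0; exists k.
have phiE c : c \in [:: 0; N] -> grid K (fun l => phi (map (cons c) l)) = false.
  move=> cN; apply: grid_cell => p l _ _; apply: phi0; exists 0 => //.
  by exists c => // v /mapP[w _ ->].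
by rewrite !phiE // !inE eqxx ?orbT.
Qed.

(* On the faces orthogonal to a positive coordinate [cup (F 0) ...] vanishes,
   and on the two remaining faces [F 0] is 1 and 0: Stokes reduces the sum to
   the same sum in dimension [K]. *)
Lemma grid_grad K (F : nat -> seq nat -> bool) :
    (forall k v, k < K -> nth 0 v k = 0 -> F k v) ->
    (forall k v, k < K -> nth 0 v k = N -> ~~ F k v) ->
  grid K (grad F K).
Proof.
elim: K F => [//|K IHK] F F0 FN.
have gradside l :
    side 1 K.+1 l -> cup (F 0) (grad (fun k => F k.+1) K) l = false.
  case: l => [//|v l] [[//|k] ltkK [c cN lc]].
  rewrite /cup (grad_const (k := k)) ?andbF // => x y xl yl.
  move: cN; rewrite !inE => /orP[] /eqP cE; rewrite cE in lc.
    by rewrite !F0 ?lc.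
  by rewrite (negPf (FN _ _ _ (lc x xl))) ?(negPf (FN _ _ _ (lc y yl))).
rewrite gradS grid_boundary //; last exact: grid_side.
rewrite [X in X (+) _]grid_cell => [|p [//|v l] _ _]; last first.
  by rewrite map_cons /cup (negPf (FN 0 _ _ _)).
rewrite addFb (@eq_grid _ _ (grad (fun k => F k.+1 \o cons 0) K)).
  by apply: IHK => k v ltkK vk; [apply: (F0 k.+1)|apply: (FN k.+1)].
case=> [|v l]; last by rewrite map_cons /cup (F0 0) //= -map_cons grad_map.
by case: (K).
Qed.

(* A combinatorial form of the Poincare-Miranda theorem. *)
Lemma grid_sign_change K (F : nat -> seq nat -> bool) :
    (forall k v, k < K -> nth 0 v k = 0 -> F k v) ->
    (forall k v, k < K -> nth 0 v k = N -> ~~ F k v) ->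
  exists2 p, (forall k, k < K -> nth 0 p k < N) &
    forall k, k < K ->
      exists v w, [/\ cell K p v, cell K p w, F k v & ~~ F k w].
Proof.
(* The sum being odd, [grad] is nonzero on some simplex inside a cell, and by [grad_const] no label
   is constant there. *)
move=> F0 FN; have := grid_grad F0 FN; apply: contraPP => noP.
rewrite grid_cell // => p l pN lp; apply: contrapT => gradl; apply: noP.
exists p => // k ltkK; have [/hasP[v vl Fv]|/hasPn nF] := boolP (has (F k) l).
  have [/hasP[w wl Fw]|/hasPn aF] := boolP (has (fun w => ~~ F k w) l).
    by exists v, w; split=> //; apply: lp.
  case: gradl; apply: (grad_const ltkK) => x y xl yl.
  by move: (aF x xl) (aF y yl); rewrite !negbK => -> ->.
case: gradl; apply: (grad_const ltkK) => x y xl yl.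
by rewrite (negPf (nF x xl)) (negPf (nF y yl)).
Qed.
End Grid.

(** * Brouwer's theorem on the cube *)

Import Order.TTheory GRing.Theory Num.Theory.
Local Open Scope classical_set_scope.
Local Open Scope ring_scope.

Lemma cube_sign_change (R : realType) K (T : 'rV[R]_K -> 'I_K -> R) (e : R) :
    (forall x j, 0 <= T x j <= 1) -> 0 < e ->
  exists2 p : 'rV[R]_K, (forall j, 0 <= p 0 j <= 1) &
    forall j, exists y z, [/\ ball p e y, ball p e z,
      y 0 j <= T y j & T z j <= z 0 j].
Proof.
move=> T01 e0.
have [n _ /(_ _ (leqnn n)) /= ne] := near_infty_natSinv_lt (PosNum e0).
set N := n.+1 in ne; pose pt v : 'rV[R]_K := \row_j ((nth 0%N v j)%:R / N%:R).
(* The first conjunct turns the label off on the upper face even where [T] reaches 1; the wanted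
   [T z j <= z 0 j] still holds there, since [T] is at most 1. *)
pose F k v := (nth 0%N v k < N)%N &&
  [forall j : 'I_K, (val j == k) ==> (pt v 0 j <= T (pt v) j)].
have N0 : 0 < N%:R :> R by rewrite ltr0n.
have [k v kK vk|k v kK vk|p pN pF] := @grid_sign_change N K F.
- rewrite /F vk /=; apply/forallP => j; apply/implyP => /eqP jk.
  by rewrite mxE jk vk mul0r; case/andP: (T01 (pt v) j).
- by rewrite /F vk ltnn.
exists (pt p) => [j|j].
  by rewrite mxE divr_ge0 // ler_pdivrMr // mul1r ler_nat ltnW // pN.
have cellP v : cell K p v -> ball (pt p) e (pt v).
  move=> pv; split=> // i k.
  rewrite /ball /= !mxE -mulrBl normrM (@gtr0_norm _ N%:R^-1) ?invr_gt0 //.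
  rewrite (le_lt_trans _ ne) // -[leRHS]mul1r ler_pM2r ?invr_gt0 //.
  have /andP[pv1 pv2] := pv k (ltn_ord k).
  by rewrite distrC -natrB // normr_nat (ler_nat _ _ 1) leq_subLR addn1.
have [v [w [/cellP pv /cellP pw /andP[_ /forallP/(_ j) Fv] nFw]]] :=
  pF j (ltn_ord j).
move: Fv => /implyP/(_ (eqxx _)) Fv.
exists (pt v), (pt w); split=> //; move: nFw; rewrite negb_and -leqNgt.
case/orP => [Nw|/forallPn[k]].
  rewrite (le_trans (andP (T01 _ _)).2) // mxE ler_pdivlMr // mul1r ler_nat //.
by rewrite negb_imply => /andP[/eqP/val_inj ->]; rewrite -ltNge => /ltW.
Qed.

(** Without a fixed point, compactness gives one radius [e] such that on the [e]-ball around any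
    point of the cube some coordinate of [T y - y] keeps a strict sign, against
    [cube_sign_change]. *)
Lemma brouwer_cube (R : realType) K (T : 'rV[R]_K -> 'I_K -> R) :
    (forall j, continuous (T ^~ j)) -> (forall x j, 0 <= T x j <= 1) ->
  exists x, forall j, T x j = x 0 j.
Proof.
move=> Tc T01; apply: contrapT => nofix.
pose B := [set x : 'rV[R]_K | forall j, x 0 j \in `[0, 1]].
have Bco : compact B.
  apply: (@rV_compact R K (fun=> `[0, 1]%classic)) => j.
  exact: segment_compact.
pose P (e : R) (x : 'rV[R]_K) := exists j,
  (forall y, ball x e y -> y 0 j < T y j) \/
  (forall y, ball x e y -> T y j < y 0 j).
have : \forall e \near 0^'+, B `<=` P e.
  apply: (compact_near_coveringP B).1 => // x _.
  have [j Txj] : exists j, T x j != x 0 j.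
    apply: contrapT => nj; apply: nofix; exists x => j; apply/eqP.
    by apply: contrapT => /negP Txj; apply: nj; exists j.
  have hc : continuous (fun y => T y j - y 0 j).
    by move=> y; apply: (cvgB (Tc j y)); exact: coord_continuous.
  have key Q : (\forall y \near x, Q y) ->
      \forall x' \near x & e \near 0^'+, forall y, ball x' e y -> Q y.
    move=> /nbhs_ballP[d /= d0 dQ].
    exists (ball x (d / 2), [set e | e < d / 2]) => /=.
      split; first by apply: nbhsx_ballx; rewrite divr_gt0.
      by apply: nbhs_right_lt; rewrite divr_gt0.
    move=> [x' e] /= [xx' ed] y x'y; apply: dQ; rewrite [d]splitr.
    by apply: ball_triangle xx' _; apply: le_ball x'y; exact: ltW.
  move: Txj; rewrite neq_lt => /orP[lt|lt].
    have /key : \forall y \near x, T y j - y 0 j < 0.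
      by apply: (cvgr_lt _ (hc x)); rewrite subr_lt0.
    apply: filterS => -[x' e] /= H; exists j; right => y /H.
    by rewrite subr_lt0.
  have /key : \forall y \near x, 0 < T y j - y 0 j.
    by apply: (cvgr_gt _ (hc x)); rewrite subr_gt0.
  apply: filterS => -[x' e] /= H; exists j; left => y /H.
  by rewrite subr_gt0.
move=> /(filterI (nbhs_right_gt _)) /filter_ex[e [/= e0 BP]].
have [p p01 pT] := @cube_sign_change _ _ T e T01 e0.
have [|j [Py|Pz]] := BP p; first by move=> j; rewrite in_itv /= p01.
- by have [y [z [_ /Py + _]]] := pT j; rewrite ltNge => /negP.
- by have [y [z [/Pz + _ +]]] := pT j; rewrite ltNge => /negP.
Qed.

(** * Filling simplices in a semilattice *)

(** Precomposing a path with the clamp onto [[0, 1]] makes it continuous on the whole line. *)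
Lemma path_extension (R : realType) (d : Order.disp_t)
    (T : POrderedTopological.type d) (x y : T) :
    path_connected_intervals R T -> (x <= y)%O ->
  exists gam : R -> T, [/\ continuous gam, forall t : R, t <= 0 -> gam t = y,
    forall t : R, 1 <= t -> gam t = x & forall t, (x <= gam t <= y)%O].
Proof.
move=> /(_ x y) xy xley; have [||g [gc g0 g1 gxy]] := xy xley y x.
- by rewrite /= in_itv /= lexx xley.
- by rewrite /= in_itv /= lexx xley.
pose c (t : R) := Num.max 0 (Num.min 1 t).
have c01 t : `[0, 1]%classic (c t).
  by rewrite /= in_itv /= /c le_max lexx /= ge_max ler01 ge_min lexx.
exists (g \o c); split=> [t|t t0|t t1|t].
- have cc : {for t, continuous c}.
    apply: (@continuous_max _ _ (cst 0)); first exact: cst_continuous.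
    by apply: (@continuous_min _ _ (cst 1) id) => //; exact: cst_continuous.
  move=> V /((subspace_continuousP _ _).1 gc (c t) (c01 t)) /cc.
  by apply: (@filterS _ (nbhs t)) => s; apply; exact: c01.
- by rewrite /= /c (min_idPr _) ?(max_idPl _) // (le_trans t0).
- by rewrite /= /c (min_idPl _) ?(max_idPr _).
- by have := gxy (g (c t)) (imageP _ (c01 t)); rewrite /= in_itv.
Qed.

Section SemilatticeFilling.
Context (R : realType) (d : Order.disp_t) (T : POrderedTopological.type d).
Context (T_semilattice : topological_inf_semilattice T).
Context (T_intervals : path_connected_intervals R T).
Context (Y : topologicalType) (I : finType).

(* [gam (a, b)] runs from [A a] down to the infimum of [A a] and [A b], and
   [f y] is the infimum of the points [gam (a, b) (t a b y)] over all [a] of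
   weight at least 1/2 and all [b].  At weight 1/2 the index [a] enters with the
   single constraint [A a], which a vertex of weight 1 has already imposed:
   hence [f] is continuous. *)
Lemma semilattice_filling (w : Y -> I -> R) (A : I -> T) :
    (forall a, continuous (w ^~ a)) -> (forall y, exists a, w y a = 1) ->
  exists f : Y -> T, continuous f /\
    forall y b, (forall a, 0 < w y a -> (b <= A a)%O) -> (b <= f y)%O.
Proof.
move=> wc w1; have [meet [meet_inf meet_cont]] := T_semilattice.
have lemeet z x y : (z <= meet x y)%O = (z <= x)%O && (z <= y)%O.
  have [mlb mglb] := meet_inf x y; apply/idP/andP => [zm|[zx zy]].
    by split; apply: le_trans zm _; apply: mlb => /=; [left|right].
  by apply: mglb => _ [] ->.
have lebm z x s : (z <= foldr meet x s)%O = (z <= x)%O && all (>= z)%O s.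
  by elim: s => [|y s IHs] /=; rewrite ?andbT // lemeet IHs andbCA.
have bmc (f0 : Y -> T) (h : I -> Y -> T) (s : seq I) : continuous f0 ->
    (forall a, continuous (h a)) ->
    continuous (fun y => foldr meet (f0 y) [seq h a y | a <- s]).
  move=> f0c hc; elim: s => [//|a s IHs] y /=.
  apply: (@continuous_comp _ _ _ (fun y => (h a y, _)) (fun p => meet p.1 p.2)).
    by apply: cvg_pair; [exact: hc|exact: IHs].
  exact: meet_cont.
have meetl x y : (meet x y <= x)%O.
  by have := lemeet (meet x y) x y; rewrite lexx => /esym/andP[].
have /choice[gam gamP] (ab : I * I) :=
  path_extension T_intervals (meetl (A ab.1) (A ab.2)).
(* At most 0 if [a] has weight at most 1/2 or [b] weight at most 0; at least 1 if [a] has weight 1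
   and [b] weight at least 1/2. *)
pose t a b y := Num.min (2 * w y a - 1) (2 * w y b).
pose h a y := foldr meet (A a) [seq gam (a, b) (t a b y) | b <- enum I].
have leh z a y : (z <= h a y)%O <->
    (z <= A a)%O /\ forall b, (z <= gam (a, b) (t a b y))%O.
  rewrite lebm all_map; split=> [/andP[-> /allP zb]|[-> zb]].
    by split=> // b; apply: zb; rewrite mem_enum.
  by apply/allP => b _; exact: zb.
have hc a : continuous (h a).
  apply: bmc; first exact: cst_continuous.
  move=> b y; have [gc _ _ _] := gamP (a, b).
  apply: (@continuous_comp _ _ _ (t a b) (gam (a, b))); last exact: gc.
  apply: continuous_min.
    apply: cvgB; last exact: cvg_cst.
    by apply: cvgM; [exact: cvg_cst|exact: wc].
  by apply: cvgM; [exact: cvg_cst|exact: wc].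
have [q wq] := choice w1.
(* For lack of a greatest element the infimum is seeded with [h q y]; for [q] in [S] the choice of
   [q] is immaterial. *)
pose G (S : {set I}) q y := foldr meet (h q y) [seq h a y | a <- enum S].
pose S y := [set a | 1 / 2 <= w y a]%SET.
have leG z (U : {set I}) q0 y : q0 \in U -> (z <= G U q0 y)%O <->
    forall a, a \in U -> (z <= h a y)%O.
  move=> q0U; rewrite lebm all_map; split=> [/andP[_ /allP zU] a aU|zU].
    by apply: zU; rewrite mem_enum.
  by rewrite zU //; apply/allP => a; rewrite mem_enum; exact: zU.
have qS y : q y \in S y by rewrite inE wq; lra.
exists (fun y => G (S y) (q y) y); split=> [y0|y b bA]; last first.
  apply/leG => // a; rewrite inE => wa; apply/leh; split=> [|c].
    by apply: bA; lra.
  have [_ gam0 _ /(_ (t a c y))/andP[legam _]] := gamP (a, c).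
  have [wc0|wc0] := ltP 0 (w y c).
    by apply: le_trans legam; rewrite lemeet !bA //; lra.
  rewrite gam0 ?bA //; first by lra.
  by rewrite /t ge_min; apply/orP; right; lra.
have GE (U : {set I}) : (forall a, 1 / 2 < w y0 a -> a \in U) ->
    (forall a, a \in U -> 1 / 2 <= w y0 a) ->
    G U (q y0) y0 = G (S y0) (q y0) y0.
  move=> SU US; have qU : q y0 \in U by apply: SU; rewrite wq; lra.
  apply/le_anti/andP; split; last first.
    apply/leG => // a aU; apply: ((leG _ _ _ _ (qS y0)).1 (lexx _)).
    by rewrite inE US.
  apply/leG => // a; rewrite inE le_eqVlt => /predU1P[wa|/SU aU]; last first.
    exact: ((leG _ _ _ y0 qU).1 (lexx _)).
  have Aa : (G U (q y0) y0 <= A a)%O.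
    have := ((leh _ _ _).1 ((leG _ _ _ y0 qU).1 (lexx _) _ qU)).2 a.
    have [_ _ gam1 _] := gamP (q y0, a).
    rewrite gam1 ?lemeet => [/andP[]//|].
    by rewrite /t le_min wq -wa; apply/andP; split; lra.
  apply/leh; split=> // c; have [_ gam0 _ _] := gamP (a, c).
  by rewrite gam0 // /t ge_min -wa; apply/orP; left; lra.
move=> V; rewrite /= => Vy0.
(* Near [y0], [S y] is one of finitely many sets [U] between the strict and weak level sets at [y0];
   for fixed [U] the infimum is continuous, and by [GE] all agree at [y0]. *)
have Sy0 : \forall y \near y0, forall a,
    (1 / 2 < w y0 a -> a \in S y) /\ (a \in S y -> 1 / 2 <= w y0 a).
  apply: filter_forall => a; have [wa|wa|wa] := ltgtP (1 / 2) (w y0 a).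
  - have : \forall y \near y0, 1 / 2 < w y a by exact: (cvgr_gt _ (wc a y0)).
    by apply: filterS => y way; split=> // _; rewrite inE ltW.
  - have : \forall y \near y0, w y a < 1 / 2 by exact: (cvgr_lt _ (wc a y0)).
    by apply: filterS => y way; split=> //; rewrite inE leNgt way.
  - by apply: nearW.
have VG : \forall y \near y0, forall U : {set I},
    (forall a, 1 / 2 < w y0 a -> a \in U) ->
    (forall a, a \in U -> 1 / 2 <= w y0 a) -> V (G U (q y0) y).
  apply: filter_forall => U.
  have [SU|nSU] := pselect (forall a, 1 / 2 < w y0 a -> a \in U); last first.
    by apply: nearW => y /nSU.
  have [US|nUS] := pselect (forall a, a \in U -> 1 / 2 <= w y0 a); last first.
    by apply: nearW => y _ /nUS.
  have : nbhs (G U (q y0) y0) V by rewrite GE.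
  move=> /(bmc _ _ (enum U) (hc (q y0)) hc); rewrite nbhs_simpl /=.
  by apply: filterS.
apply: filterS2 Sy0 VG => y Sy VGy.
have qSy : q y0 \in S y by apply: (Sy _).1; rewrite wq; lra.
rewrite /preimage /=; have -> : G (S y) (q y) y = G (S y) (q y0) y.
  apply/le_anti/andP; split; apply/leG => // a.
    exact: ((leG _ _ _ y (qS y)).1 (lexx _)).
  exact: ((leG _ _ _ y qSy).1 (lexx _)).
by apply: VGy => a; [exact: (Sy a).1|exact: (Sy a).2].
Qed.
End SemilatticeFilling.

(** * Nash points *)

Lemma continuous_bigmax (R : realType) (Y : topologicalType) (I : finType)
    (f : I -> Y -> R) :
  (forall k, continuous (f k)) ->
  continuous (fun y => \big[Num.max/0]_k f k y).
Proof.
move=> fc; rewrite -[X in continuous X]/(fun y =>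
  \big[Num.max/0]_(k <- index_enum I) f k y).
elim: (index_enum I) => [|k s IHs].
  by under eq_fun do rewrite big_nil; exact: cst_continuous.
under eq_fun do rewrite big_cons.
by move=> y; apply: (@continuous_max _ _ (f k)); [exact: fc|exact: IHs].
Qed.

Lemma continuous_normalize (R : realType) (Y : topologicalType) (I : finType)
    (f : I -> Y -> R) :
  (forall k, continuous (f k)) ->
  forall k, continuous (fun y => 1 + `|f k y| - \big[Num.max/0]_l `|f l y|).
Proof.
move=> fc k; have fnc l : continuous (fun y => `|f l y|).
  by move=> y; apply: (continuous_comp (fc l y)); exact: norm_continuous.
move=> y; apply: cvgB; last exact: continuous_bigmax.
by apply: cvgD; [exact: cvg_cst|exact: fnc].
Qed.

Lemma continuous_prod_topology (Y : topologicalType) (I : eqType)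
    (K : I -> topologicalType) (f : Y -> prod_topology K) :
  (forall i, continuous (fun y => f y i)) -> continuous f.
Proof.
move=> fc y; apply/cvg_sup => i V [_ [[W oW <-] Wfy WV]].
apply: (@filterS _ (nbhs y) _ (fun z => W (f z i))); first by move=> z /WV.
by apply: (fc i y); apply: open_nbhs_nbhs.
Qed.

Lemma continuous_dfwith (Y : topologicalType) (I : eqType)
    (K : I -> topologicalType) (f : Y -> prod_topology K) i (z : K i) :
  continuous f -> continuous (fun y => dfwith (f y) i z : prod_topology K).
Proof.
move=> fc; apply: continuous_prod_topology => j.
have [<-|ij] := eqVneq i j.
  by under eq_fun do rewrite dfwithin; exact: cst_continuous.
under eq_fun do rewrite dfwithout //.
move=> y; apply: (@continuous_comp _ _ _ f (@proj I K j)); first exact: fc.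
exact: proj_continuous.
Qed.

Lemma dfwith_id (I : eqType) (K : I -> Type) (x : forall i, K i) i :
  dfwith x i (x i) = x.
Proof. by apply: functional_extensionality_dep => j; case: dfwithP. Qed.

Lemma continuous_gain (R : realType) (Y : topologicalType) (I : eqType)
    (K : I -> topologicalType) (u : prod_topology K -> R)
    (x : Y -> prod_topology K) i (z : K i) :
    continuous u -> continuous x ->
  continuous (fun y => u (dfwith (x y) i z) - u (x y)).
Proof.
move=> uc xc.
have uxc (f : Y -> prod_topology K) : continuous f -> continuous (u \o f).
  by move=> fc y; apply: continuous_comp; [exact: fc|exact: uc].
have udfc := uxc _ (@continuous_dfwith _ _ _ _ i z xc).
by move=> y; apply: cvgB; [exact: udfc|exact: uxc].
Qed.

Lemma continuous_clamp (R : realType) (Y : topologicalType) (f g h : Y -> R) :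
    continuous f -> continuous g -> continuous h ->
  continuous (fun y => Num.max 0 (Num.min 1 (f y + (g y - h y / 2)))).
Proof.
move=> fc gc hc.
have ghc : continuous (fun y => g y - h y / 2).
  by move=> y; apply: cvgB; [exact: gc|apply: cvgM; [exact: hc|exact: cvg_cst]].
have fghc : continuous (fun y => f y + (g y - h y / 2)).
  by move=> y; apply: cvgD; [exact: fc|exact: ghc].
move=> y; apply: (@continuous_max R Y (cst 0) (fun y => Num.min 1 _)).
  exact: cst_continuous.
by apply: (@continuous_min R Y (cst 1)); [exact: cst_continuous|exact: fghc].
Qed.

Lemma bigmax_attained (R : realType) (I : finType) (F : I -> R) :
  0 < \big[Num.max/0]_k F k -> exists k, \big[Num.max/0]_k F k = F k.
Proof.
elim/big_ind: _ => [|x y IHx IHy|k _ _]; first by rewrite ltxx.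
  by rewrite /Num.max; case: ifP.
by exists k.
Qed.

(** * Equilibrium against finitely many deviations *)

Section FiniteDeviations.
Context (R : realType) (n : nat) (d : Order.disp_t).
Context (X : 'I_n -> POrderedTopological.type d).
Context (u : 'I_n -> prod_topology X -> R).
Context (u_iql : individually_quasi_leontief_game u).
Context (X_semilattice : forall i, topological_inf_semilattice (X i)).
Context (X_intervals : forall i, path_connected_intervals R (X i)).
Context (u_continuous : forall i, continuous (u i)).

Lemma finite_deviations m (p : 'I_m.+1 -> prod_topology X) :
  exists x : prod_topology X, forall k i, u i (dfwith x i (p k i)) <= u i x.
Proof.
pose J : finType := ('I_n * 'I_m.+1)%type; pose V := 'rV[R]_#|J|.
pose lam (v : V) (i : 'I_n) (k : 'I_m.+1) : R := v 0 (enum_rank (i, k)).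
have lamc i k : continuous (lam ^~ i ^~ k) by exact: coord_continuous.
pose mu i (v : V) : R := \big[Num.max/0]_k `|lam v i k|.
(* The shift makes the largest weight exactly 1, and it is the identity on nonnegative entries with
   maximum 1, the case met at the fixed point. *)
pose w i v k : R := 1 + `|lam v i k| - mu i v.
have wc i k : continuous ((w i) ^~ k) by exact: continuous_normalize (lamc i) k.
have w1 i v : exists k, w i v k = 1.
  have [/bigmax_attained[k muk]|mu0] := ltP 0 (mu i v).
    by exists k; rewrite /w /mu muk addrK.
  have lam0 : `|lam v i ord0| = mu i v.
    apply/le_anti; rewrite [X in X && _](le_bigmax _ _ ord0).
    exact: le_trans mu0 _.
  by exists ord0; rewrite /w lam0 addrK.
have F i := semilattice_filling (X_semilattice i) (@X_intervals i)
  (p ^~ i) (wc i) (w1 i).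
pose f i := projT1 (cid (F i)).
have fc i : continuous (f i) := (projT2 (cid (F i))).1.
have fP i := (projT2 (cid (F i))).2; rewrite -/(f _) in fP.
pose x (v : V) : prod_topology X := fun i => f i v.
have xc : continuous x by apply: continuous_prod_topology => i; exact: fc.
pose gain i k v : R := u i (dfwith (x v) i (p k i)) - u i (x v).
have gainc i k : continuous (gain i k) by exact: continuous_gain.
pose M i v : R := \big[Num.max/0]_k gain i k v.
have Mc i : continuous (M i) by exact: continuous_bigmax (gainc i).
pose T v (j : 'I_#|J|) : R := let: (i, k) := enum_val j in
  Num.max 0 (Num.min 1 (lam v i k + (gain i k v - M i v / 2))).
have [|v j|v Tv] := @brouwer_cube R _ T.
- move=> j; rewrite /T; case: (enum_val j) => i k.
  exact: continuous_clamp (lamc i k) (gainc i k) (Mc i).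
- rewrite /T; case: (enum_val j) => i k.
  by rewrite le_max lexx ge_max ler01 ge_min lexx.
exists (x v) => k i; rewrite -subr_le0 -/(gain i k v).
have lamE h : lam v i h =
    Num.max 0 (Num.min 1 (lam v i h + (gain i h v - M i v / 2))).
  by rewrite {1}/lam -Tv /T enum_rankK.
have gainM h : gain i h v <= M i v by exact: le_bigmax.
apply: le_trans (gainM k) _; rewrite leNgt; apply/negP => M0.
have [h Mh] := bigmax_attained M0.
rewrite -/(M i v) in Mh.
have lam01 l : 0 <= lam v i l <= 1.
  by rewrite lamE le_max lexx ge_max ler01 ge_min lexx.
(* The update adds [M i v / 2 > 0] here, so a fixed entry must sit at the cap 1. *)
have lam1 : lam v i h = 1.
  have := lamE h; move: (lam01 h) Mh M0.
  move: (M i v) (gain i h v) (lam v i h) => M' g l.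
  by rewrite /Num.max /Num.min; do !case: ifP; lra.
have mu1 : mu i v = 1.
  apply/le_anti/andP; split.
    apply/bigmax_leP; split=> // l _; have /andP[l0 l1] := lam01 l.
    by rewrite ger0_norm.
  by apply: le_trans (le_bigmax _ _ h); rewrite lam1 normr1.
have wE l : w i v l = lam v i l.
  have /andP[l0 _] := lam01 l.
  by rewrite /w mu1 ger0_norm // addrAC subrr add0r.
(* An entry that the update lowers can only be fixed at 0. *)
have supp l : 0 < lam v i l -> M i v / 2 <= gain i l v.
  have := lamE l; move: (lam01 l) M0.
  move: (M i v) (gain i l v) (lam v i l) => M' g l'.
  by rewrite /Num.max /Num.min; do !case: ifP; lra.
have h_supp : 0 < lam v i h by rewrite lam1.
pose U (z : X i) := u i (dfwith (x v) i z).
(* All supported deviations lie in the principal filter of replies at least as good as the worst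
   supported one, [l]; hence so does [x v i], and the gain of [l] cannot be positive. *)
have [l lsupp lmin] :=
  @arg_minP _ _ _ h (fun l => 0 < lam v i l) (fun l => U (p l i)) h_supp.
have [a aE] := @u_iql i i (x v) (p l i).
have ale (z : X i) : (U (p l i) <= U z) <-> (a <= z)%O.
  by have /= := congr1 (fun S : set (X i) => S z) aE; rewrite /U => ->.
have /ale : (a <= x v i)%O by apply: fP => l'; rewrite wE => /lmin /ale.
rewrite /U dfwith_id; have := supp _ lsupp; rewrite /gain.
move: M0; lra.
Qed.
End FiniteDeviations.

(** * Passage to all deviations by compactness *)

Theorem theorem3p0p2 (R : realType) (n : nat) (d : Order.disp_t)
    (X : 'I_n -> POrderedTopological.type d)
    (u : 'I_n -> prod_topology X -> R)
    (n_ge1 : (1 <= n)%N)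
    (X_nonempty : forall i, [set: X i] !=set0)
    (u_iql : individually_quasi_leontief_game u)
    (X_compact : forall i, compact [set: X i])
    (X_metrizable : forall i, metrizable R (X i))
    (X_semilattice : forall i, topological_inf_semilattice (X i))
    (X_intervals : forall i, path_connected_intervals R (X i))
    (u_continuous : forall i, continuous (u i)) :
  exists x : prod_topology X, nash_point u x.
Proof.
pose x0 : prod_topology X := fun i => projT1 (cid (X_nonempty i)).
pose N (p : prod_topology X) := [set x : prod_topology X |
  forall i, u i (dfwith x i (p i)) <= u i x].
have finN : finI setT N.
  move=> D _; pose s := enum_fset D.
  (* The successor keeps the index type inhabited when [D] is empty; the extra index yields the
     default [x0]. *)
  have [x Nx] := @finite_deviations _ _ _ _ _ u_iql X_semilattice X_intervals
    u_continuous _ (fun k : 'I_(size s).+1 => nth x0 s k).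
  exists x => p /= pD i; have ltps : (index p s < (size s).+1)%N.
    by rewrite ltnS index_size.
  by have := Nx (Ordinal ltps) i; rewrite /= nth_index.
have Xco : compact [set: prod_topology X].
  have := tychonoff X_compact; congr compact.
  by apply/seteqP; split.
(* [x] is a cluster point of the filter generated by the sets [N p]. A strict improvement at [x]
   would persist on a neighbourhood, which must meet [N p]. *)
have [|x [_ xN]] := Xco _ (finI_filter finN).
  exact: (@filterT _ _ (@filter_filter _ _ (finI_filter finN))).
exists x => i z; rewrite leNgt; apply/negP => ltu.
pose p : prod_topology X := dfwith x0 i z.
have gc := continuous_gain (z := z) (u_continuous i) (fun y => cvg_id).
have near_gt : \forall y \near x, 0 < u i (dfwith y i z) - u i y.
  by apply: (cvgr_gt _ (gc x)); rewrite subr_gt0.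
have FNp : filter_from (finI_from setT N) id (N p).
  by exists (N p) => //; exact: finI_from1.
have [y [/(_ i) Npy]] := xN _ _ FNp near_gt.
by rewrite /= subr_gt0 ltNge -{1}(dfwithin x0 z) Npy.
Qed.
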